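(* Let $v(t,x)=\sum_{k=1}^Kv_k(t,x_{S_k})$ with $v_k\in C^1([t_0,T]\times X_{S_k})$, and suppose the running cost and dynamics admit compatible decompositions $$\ell(t,x,u)=\sum_{k=1}^K\ell_k(t,x_{N_k},u_{M_k}),\qquad f_{S_k}(t,x,u)=f_k(t,x_{N_k},u_{M_k})\quad\text{for every }k.$$ Then the HJB slack $s_v:=\ell+L_fv$ decomposes as $$s_v(t,x,u)=\sum_{k=1}^Ks_k(t,x_{N_k},u_{M_k}),\qquad s_k:=\ell_k+A_kv_k.$$
   Context: Setting. $t_0<T$, $X\subseteq\mathbb R^n$, $U\subseteq\mathbb R^m$, $Z:=[t_0,T]\times X\times U$, dynamics $f:Z\to\mathbb R^n$, running cost $\ell:Z\to\mathbb R$. For $v\in C^1([t_0,T]\times X)$, $(L_fv)(t,x,u):=\partial_tv(t,x)+\nabla_xv(t,x)^\top f(t,x,u)$. Index sets: $S_k\subseteq\{1,\dots,n\}$ ($k=1,\dots,K$), state neighborhoods $N_k\supseteq S_k$, $N_k\subseteq\{1,\dots,n\}$, and control index sets $M_k\subseteq\{1,\dots,m\}$. $x_S$ (resp. $u_M$, $f_S$) denotes the subvector of components indexed by $S$ (resp. $M$, $S$), and $X_S$ is the projection of $X$ onto the coordinates in $S$. The blockwise transport operator is $$(A_k\phi)(t,x_{N_k},u_{M_k}):=\partial_t\phi(t,x_{S_k})+\nabla_{x_{S_k}}\phi(t,x_{S_k})^\top f_k(t,x_{N_k},u_{M_k}),\qquad\phi\in C^1([t_0,T]\times X_{S_k}).$$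 *)

(* Defs.v *)
From HB Require Import structures.
From mathcomp Require Import all_boot all_order all_algebra.
From mathcomp Require Import all_classical all_reals all_analysis.
Set Implicit Arguments.
Unset Strict Implicit.
Unset Printing Implicit Defensive.
Import Order.TTheory GRing.Theory Num.Theory.
Import numFieldNormedType.Exports.
Local Open Scope classical_set_scope.
Local Open Scope ring_scope.

(* The subvector x_A, its coordinates listed in increasing order of index. *)
Definition subvec (R : Type) (n : nat) (A : {set 'I_n}) (x : 'rV[R]_n) :
  'rV[R]_#|A| := colsub (fun j : 'I_#|A| => enum_val j) x.

(* For A \subset B, the projection of R^B onto R^A: it sends x_B to x_A. *)
Definition subvec_in (R : Type) (n : nat) (A B : {set 'I_n})
    (sAB : A \subset B) (y : 'rV[R]_#|B|) : 'rV[R]_#|A| :=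
  colsub (fun j : 'I_#|A| =>
    enum_rank_in (fintype.subsetP sAB _ (enum_valP j)) (enum_val j)) y.

Section C1.
Context {R : realType} {p : nat}.

(* A is an arbitrary set (not assumed open, or regular in any way), so phi is
   C^1 on A when it is C^1 on an open neighbourhood of A.  A function in C^1(A)
   is given by such an extension, which is what the derivatives below apply
   to. *)
Definition C1_on (A : set (R * 'rV[R]_p)) (phi : R * 'rV[R]_p -> R) :=
  exists W : set (R * 'rV[R]_p), [/\ open W, A `<=` W &
    forall z, W z -> differentiable phi z /\
      forall h, {for z, continuous ('D_h phi)}].

Definition partial_t (phi : R * 'rV[R]_p -> R) (t : R) (x : 'rV[R]_p) : R :=
  'D_(1, 0) phi (t, x).

Definition grad_x (phi : R * 'rV[R]_p -> R) (t : R) (x : 'rV[R]_p) :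
    'rV[R]_p :=
  \row_i 'D_(0, delta_mx 0 i) phi (t, x).

End C1.

Definition dotv (R : realType) (p : nat) (a b : 'rV[R]_p) : R :=
  (a *m b^T) 0 0.

Section Slack.
Context {R : realType} {n m : nat}.

Definition transport (f : R -> 'rV[R]_n -> 'rV[R]_m -> 'rV[R]_n)
    (v : R * 'rV[R]_n -> R) (t : R) (x : 'rV[R]_n) (u : 'rV[R]_m) : R :=
  partial_t v t x + dotv (grad_x v t x) (f t x u).

Definition hjb_slack (l : R -> 'rV[R]_n -> 'rV[R]_m -> R)
    (f : R -> 'rV[R]_n -> 'rV[R]_m -> 'rV[R]_n)
    (v : R * 'rV[R]_n -> R) (t : R) (x : 'rV[R]_n) (u : 'rV[R]_m) : R :=
  l t x u + transport f v t x u.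

Variables (S N : {set 'I_n}) (M : {set 'I_m}) (sSN : S \subset N).

(* phi depends on x_S only, but its transport is a function of y = x_N and
   w = u_M. *)
Definition block_transport
    (fk : R -> 'rV[R]_#|N| -> 'rV[R]_#|M| -> 'rV[R]_#|S|)
    (phi : R * 'rV[R]_#|S| -> R)
    (t : R) (y : 'rV[R]_#|N|) (w : 'rV[R]_#|M|) : R :=
  partial_t phi t (subvec_in sSN y) +
  dotv (grad_x phi t (subvec_in sSN y)) (fk t y w).

Definition block_slack
    (lk : R -> 'rV[R]_#|N| -> 'rV[R]_#|M| -> R)
    (fk : R -> 'rV[R]_#|N| -> 'rV[R]_#|M| -> 'rV[R]_#|S|)
    (vk : R * 'rV[R]_#|S| -> R)
    (t : R) (y : 'rV[R]_#|N|) (w : 'rV[R]_#|M|) : R :=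
  lk t y w + block_transport fk vk t y w.

End Slack.

(* Main.v *)
(* The projection (t, x) |-> (t, x_A) is linear, so a difference quotient of
   phi(t, x_A) is a difference quotient of phi in the projected direction:
   partial derivatives along i \in A are those of phi and the others vanish,
   hence only the components f_A enter the transport term.  Differentiability
   of the v_k is what lets the transport operator distribute over their sum. *)

Require Import Defs.
From HB Require Import structures.
From mathcomp Require Import all_boot all_order all_algebra.
From mathcomp Require Import all_classical all_reals all_analysis.
Set Implicit Arguments.
Unset Strict Implicit.
Unset Printing Implicit Defensive.
Import Order.TTheory GRing.Theory Num.Theory.
Import numFieldNormedType.Exports.
Local Open Scope classical_set_scope.
Local Open Scope ring_scope.

Section Subvec.
Variables (R : realType) (n : nat).
Implicit Types (A B : {set 'I_n}).

(** The block operator sees only [x_N]; this identifies the point where it differentiates [phi] as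
    the genuine [x_S]. *)
Lemma subvec_in_subvec A B (sAB : A \subset B) (x : 'rV[R]_n) :
  subvec_in sAB (subvec B x) = subvec A x.
Proof.
apply/rowP => j; rewrite !mxE enum_rankK_in //.
exact: (fintype.subsetP sAB _ (enum_valP j)).
Qed.

Lemma subvecD A (x y : 'rV[R]_n) : subvec A (x + y) = subvec A x + subvec A y.
Proof. by apply/rowP => j; rewrite !mxE. Qed.

Lemma subvecZ A (a : R) (x : 'rV[R]_n) : subvec A (a *: x) = a *: subvec A x.
Proof. by apply/rowP => j; rewrite !mxE. Qed.

Lemma subvec0 A : subvec A (0 : 'rV[R]_n) = 0.
Proof. by apply/rowP => j; rewrite !mxE. Qed.

Lemma subvec_delta A (j : 'I_#|A|) :
  subvec A (delta_mx 0 (enum_val j) : 'rV[R]_n) = delta_mx 0 j.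
Proof. by apply/rowP => i; rewrite !mxE (inj_eq enum_val_inj). Qed.

Lemma subvec_delta_notin A (i : 'I_n) :
  i \notin A -> subvec A (delta_mx 0 i : 'rV[R]_n) = 0.
Proof.
move=> iA; apply/rowP => j; rewrite !mxE eqxx /=; case: eqP => //= ij.
by rewrite -ij enum_valP in iA.
Qed.

Definition lift_block A (phi : R * 'rV[R]_#|A| -> R) (z : R * 'rV[R]_n) : R :=
  phi (z.1, subvec A z.2).

(** The quotients agree for every [a], before any limit is taken, so both the existence and the
    value of directional derivatives transfer without a chain rule. *)
Lemma lift_block_quotient A (phi : R * 'rV[R]_#|A| -> R) z h :
  (fun a : R => a^-1 *: (lift_block phi (a *: h + z) - lift_block phi z)) =
  (fun a : R => a^-1 *: (phi (a *: (h.1, subvec A h.2) + (z.1, subvec A z.2))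
                         - phi (z.1, subvec A z.2))).
Proof. by apply/funext => a; rewrite /lift_block /= subvecD subvecZ. Qed.

Lemma derivable_lift_block A (phi : R * 'rV[R]_#|A| -> R) z h :
  derivable phi (z.1, subvec A z.2) (h.1, subvec A h.2) ->
  derivable (lift_block phi) z h.
Proof. by rewrite /derivable lift_block_quotient. Qed.

Lemma derive_lift_block A (phi : R * 'rV[R]_#|A| -> R) z h :
  'D_h (lift_block phi) z = 'D_(h.1, subvec A h.2) phi (z.1, subvec A z.2).
Proof. by rewrite /derive lift_block_quotient. Qed.

Lemma partial_t_lift_block A (phi : R * 'rV[R]_#|A| -> R) t x :
  partial_t (lift_block phi) t x = partial_t phi t (subvec A x).
Proof. by rewrite /partial_t derive_lift_block subvec0. Qed.

Lemma dotv_grad_lift_block A (phi : R * 'rV[R]_#|A| -> R) t x (y : 'rV[R]_n) :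
  dotv (grad_x (lift_block phi) t x) y =
  dotv (grad_x phi t (subvec A x)) (subvec A y).
Proof.
(* The indices in [A] are renumbered by [enum_val] to match the coordinates of [subvec A y]. *)
rewrite /dotv !mxE (bigID (mem A)) /= [X in _ + X]big1 ?addr0 => [|i iA].
  rewrite big_enum_val; apply: eq_bigr => j _.
  by rewrite !mxE derive_lift_block /= subvec_delta.
(* Off [A] the projected direction is [(0, 0)], where the derivative is zero. *)
by rewrite !mxE derive_lift_block /= subvec_delta_notin // derive0 mul0r.
Qed.

End Subvec.

(** Directional derivatives add up at a point where every summand is derivable; the dot product with
    the fixed vector [f t x u] is linear. *)
Lemma transport_sum (R : realType) (n m K : nat)
    (f : R -> 'rV[R]_n -> 'rV[R]_m -> 'rV[R]_n)
    (w : 'I_K -> R * 'rV[R]_n -> R) t x u :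
  (forall k h, derivable (w k) (t, x) h) ->
  transport f (\sum_(k < K) w k) t x u = \sum_(k < K) transport f (w k) t x u.
Proof.
move=> dw; rewrite /transport big_split /=; congr (_ + _).
  by rewrite /partial_t derive_sum.
rewrite /dotv -summxE -mulmx_suml; congr ((_ *m _) 0 0).
apply/rowP => i; rewrite summxE mxE derive_sum //.
by apply: eq_bigr => k _; rewrite mxE.
Qed.

Theorem lemma2 (R : realType) (n m K : nat) (t0 T : R) (ht : t0 < T)
  (X : set 'rV[R]_n) (U : set 'rV[R]_m)
  (f : R -> 'rV[R]_n -> 'rV[R]_m -> 'rV[R]_n)
  (l : R -> 'rV[R]_n -> 'rV[R]_m -> R)
  (S N : 'I_K -> {set 'I_n}) (M : 'I_K -> {set 'I_m})
  (sSN : forall k, S k \subset N k)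
  (v_ : forall k, R * 'rV[R]_#|S k| -> R)
  (hv_ : forall k, C1_on (`[t0, T] `*` (subvec (S k) @` X)) (v_ k))
  (v : R * 'rV[R]_n -> R)
  (hv : forall (t : R) x, v (t, x) = \sum_(k < K) v_ k (t, subvec (S k) x))
  (l_ : forall k, R -> 'rV[R]_#|N k| -> 'rV[R]_#|M k| -> R)
  (f_ : forall k, R -> 'rV[R]_#|N k| -> 'rV[R]_#|M k| -> 'rV[R]_#|S k|)
  (hl : forall (t : R) x u, t0 <= t <= T -> X x -> U u ->
    l t x u = \sum_(k < K) l_ k t (subvec (N k) x) (subvec (M k) u))
  (hf : forall k (t : R) x u, t0 <= t <= T -> X x -> U u ->
    subvec (S k) (f t x u) = f_ k t (subvec (N k) x) (subvec (M k) u)) :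
  forall (t : R) x u, t0 <= t <= T -> X x -> U u ->
    hjb_slack l f v t x u =
    \sum_(k < K) block_slack (sSN k) (l_ k) (f_ k) (v_ k) t
                   (subvec (N k) x) (subvec (M k) u).
Proof.
move=> t x u tT Xx Uu.
(* The open neighbourhood in [C1_on] gives two-sided derivatives even at [t = t0], [t = T] or on the
   boundary of [X]. *)
have dv k h : derivable (v_ k) (t, subvec (S k) x) h.
  have [W [_ sW dW]] := hv_ k.
  have /sW/dW[dvk _] : (`[t0, T] `*` (subvec (S k) @` X)) (t, subvec (S k) x).
    by split; [rewrite /= in_itv | exists x].
  exact: diff_derivable.
(* An equality of functions on the whole space, so it may be used under the derivatives. *)
have -> : v = \sum_(k < K) lift_block (v_ k).
  by apply/funext => -[s y]; rewrite hv fct_sumE.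
rewrite /hjb_slack hl // transport_sum => [|k h]; last first.
  exact: derivable_lift_block.
rewrite -big_split /=; apply: eq_bigr => k _.
(* The dynamics enter only through their value at [(t, x, u)], so [hf] at that point suffices. *)
rewrite /block_slack /block_transport /transport subvec_in_subvec.
by rewrite partial_t_lift_block dotv_grad_lift_block hf.
Qed.
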